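(* Let $\mathrm{R}$ be a real closed field, $\mathrm{C}=\mathrm{R}[i]$, let $F/G \in \mathrm{C}(Z)\setminus\{0\}$ and let $\Gamma=[x_0,x_1]\times[y_0,y_1]\subset \mathrm{R}^2$ with $x_0<x_1$, $y_0<y_1$, such that $F/G$ has no zeros or poles at the vertices of $\Gamma$ (i.e. $\mathrm{val}_z(F/G)=0$ at each vertex $z$). Then $$\mathrm{w}(F/G \mid \partial\Gamma)=\sum_{z\in\Gamma} c_\Gamma(z)\,\mathrm{val}_z(F/G),$$ where $c_\Gamma(z)=1$ if $z$ is in the interior of $\Gamma$ and $c_\Gamma(z)=\tfrac12$ if $z$ lies on an edge of $\Gamma$. In words: $\mathrm{w}(F/G\mid\partial\Gamma)$ counts zeros (with multiplicity) minus poles (with order) of $F/G$ in $\Gamma$, with zeros and poles on the edges counting one half.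
   Context: Points $(x,y)\in\mathrm{R}^2$ are identified with $x+iy\in\mathrm{C}$. For nonzero $P\in\mathrm{R}[X]$ and $x\in\mathrm{R}$ write uniquely $P=(X-x)^{\mathrm{mult}_x(P)}P_x$ with $P_x(x)\neq0$; for $P,Q\neq0$ set $\mathrm{val}_x(P/Q)=\mathrm{mult}_x(P)-\mathrm{mult}_x(Q)$. For $P,Q\in\mathrm{R}[X]$, $x\in\mathrm{R}$: $\mathrm{Ind}^+_x(P,Q)=\tfrac12\,\mathrm{sign}(P_x(x)Q_x(x))$ and $\mathrm{Ind}^-_x(P,Q)=\tfrac12(-1)^{\mathrm{val}_x(P/Q)}\mathrm{sign}(P_x(x)Q_x(x))$ if $P\ne0$, $Q\neq0$ and $\mathrm{val}_x(P/Q)<0$, and both are $0$ otherwise; $\mathrm{Ind}_x=\mathrm{Ind}^+_x-\mathrm{Ind}^-_x$. For $a<b$, $\mathrm{Ind}_a^b(P,Q)=\mathrm{Ind}_a^+(P,Q)+\sum_{x\in(a,b)}\mathrm{Ind}_x(P,Q)-\mathrm{Ind}_b^-(P,Q)$; $\mathrm{Ind}_a^b=-\mathrm{Ind}_b^a$ if $b<a$, and $\mathrm{Ind}_a^a=0$. For $F\in\mathrm{C}[X,Y]$ let $F_{\rm re},F_{\rm im}\in\mathrm{R}[X,Y]$ with $F=F_{\rm re}+iF_{\rm im}$, and $\overline F=F_{\rm re}-iF_{\rm im}$. Define $\mathrm{w}(F\mid\partial\Gamma)=\tfrac12\big(\mathrm{Ind}_{x_0}^{x_1}(F_{\rm re}(T,y_0),F_{\rm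 im}(T,y_0))+\mathrm{Ind}_{y_0}^{y_1}(F_{\rm re}(x_1,T),F_{\rm im}(x_1,T))+\mathrm{Ind}_{x_1}^{x_0}(F_{\rm re}(T,y_1),F_{\rm im}(T,y_1))+\mathrm{Ind}_{y_1}^{y_0}(F_{\rm re}(x_0,T),F_{\rm im}(x_0,T))\big)$. $\mathrm{C}[Z]\subset\mathrm{C}[X,Y]$ via $Z=X+iY$. For $F,G\in\mathrm{C}[X,Y]$, $G\neq0$, $\mathrm{w}(F/G\mid\partial\Gamma):=\mathrm{w}(F\overline G\mid\partial\Gamma)$ (independent of the representation). For nonzero $F\in\mathrm{C}[Z]$, $z\in\mathrm{C}$ write $F=(Z-z)^{\mathrm{mult}_z(F)}F_z$ with $F_z(z)\ne0$, and $\mathrm{val}_z(F/G)=\mathrm{mult}_z(F)-\mathrm{mult}_z(G)$ for $F,G\ne0$. *)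

(* Defs.v *)
From HB Require Import structures.
From mathcomp Require Import all_boot all_order all_algebra.
From mathcomp Require Import polyrcf complex.

Set Implicit Arguments.
Unset Strict Implicit.
Unset Printing Implicit Defensive.

Import Order.TTheory GRing.Theory Num.Theory.
Local Open Scope ring_scope.

Definition cofactor (F : fieldType) (P : {poly F}) (x : F) : {poly F} :=
  P %/ ('X - x%:P) ^+ (mup x P).

Definition valp (F : fieldType) (P Q : {poly F}) (x : F) : int :=
  (mup x P)%:Z - (mup x Q)%:Z.

Definition Ind_plus (R : rcfType) (P Q : {poly R}) (x : R) : R :=
  if [&& P != 0, Q != 0 & valp P Q x < 0]
  then Num.sg ((cofactor P x).[x] * (cofactor Q x).[x]) / 2%:R
  else 0.

Definition Ind_minus (R : rcfType) (P Q : {poly R}) (x : R) : R :=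
  if [&& P != 0, Q != 0 & valp P Q x < 0]
  then (-1) ^ (valp P Q x) * Num.sg ((cofactor P x).[x] * (cofactor Q x).[x]) / 2%:R
  else 0.

Definition Ind_pt (R : rcfType) (P Q : {poly R}) (x : R) : R :=
  Ind_plus P Q x - Ind_minus P Q x.

(* Ind_a^b for a < b; the sum over x in ]a,b[ only has nonzero terms at
   roots of Q, which are enumerated by polyrcf's [roots Q a b]
   (the roots of Q in the open interval ]a,b[, [::] if Q = 0). *)
Definition Ind_lt (R : rcfType) (a b : R) (P Q : {poly R}) : R :=
  Ind_plus P Q a + \sum_(x <- roots Q a b) Ind_pt P Q x - Ind_minus P Q b.

Definition Ind (R : rcfType) (a b : R) (P Q : {poly R}) : R :=
  if a < b then Ind_lt a b P Q
  else if b < a then - Ind_lt b a P Q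
  else 0.

Definition hrestr (R : rcfType) (P : {poly R[i]}) (y : R) : {poly R[i]} :=
  P \Po ('X + (Complex 0 y)%:P).

Definition vrestr (R : rcfType) (P : {poly R[i]}) (x : R) : {poly R[i]} :=
  P \Po ((Complex x 0)%:P + (Complex 0 1)%:P * 'X).

(* (F * conj G)(T, y) and (F * conj G)(x, T) as polynomials in T with
   coefficients in C; conj G (x,y) = conj (G (x + i y)) for real x, y. *)
Definition hprod (R : rcfType) (F G : {poly R[i]}) (y : R) : {poly R[i]} :=
  hrestr F y * map_poly (@conjc R) (hrestr G y).

Definition vprod (R : rcfType) (F G : {poly R[i]}) (x : R) : {poly R[i]} :=
  vrestr F x * map_poly (@conjc R) (vrestr G x).

Definition repoly (R : rcfType) (H : {poly R[i]}) : {poly R} := map_poly (@complex.Re R) H.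
Definition impoly (R : rcfType) (H : {poly R[i]}) : {poly R} := map_poly (@complex.Im R) H.

(* w(F/G | dGamma) := w(F * conj G | dGamma) *)
Definition wind (R : rcfType) (F G : {poly R[i]}) (x0 x1 y0 y1 : R) : R :=
  2%:R^-1 *
  (Ind x0 x1 (repoly (hprod F G y0)) (impoly (hprod F G y0))
 + Ind y0 y1 (repoly (vprod F G x1)) (impoly (vprod F G x1))
 + Ind x1 x0 (repoly (hprod F G y1)) (impoly (hprod F G y1))
 + Ind y1 y0 (repoly (vprod F G x0)) (impoly (vprod F G x0))).

Definition croots (R : rcfType) (P : {poly R[i]}) : seq R[i] :=
  undup (sval (closed_field_poly_normal P)).

Definition inRect (R : rcfType) (x0 x1 y0 y1 : R) (z : R[i]) : bool :=
  (x0 <= complex.Re z <= x1) && (y0 <= complex.Im z <= y1).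

Definition cGamma (R : rcfType) (x0 x1 y0 y1 : R) (z : R[i]) : R :=
  if (x0 < complex.Re z < x1) && (y0 < complex.Im z < y1) then 1
  else if inRect x0 x1 y0 y1 z then 2%:R^-1 else 0.

(* Main.v *)
(* Write C = R[i] and, for a polynomial path H in C[T], let Ind H be the
   Cauchy index of (Re H, Im H).  It is additive up to boundary terms:
   if H and K do not vanish at the end points, then
     Ind (H K) = Ind H + Ind K + (c(H(a), K(a)) - c(H(b), K(b))) / 2
   with c(z, w) = sign (Im(z w) Im z Im w).  Locally, the defect
   Ind^± (H K) - Ind^± H - Ind^± K differs from a quantity that does not
   depend on the side by half the sign of Im(H K) Im H Im K just beside the
   point, and this one-sided sign telescopes along the roots.  Around a
   rectangle the boundary terms cancel, so after removing the common zeros of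
   F and G at the vertices the winding number splits over the linear factors
   of F and G; for a single factor Z - z it is computed directly. *)

Require Import Defs.
From HB Require Import structures.
From mathcomp Require Import all_boot all_order all_algebra.
From mathcomp Require Import polyrcf complex.
From mathcomp Require Import ring lra.
Import Order.TTheory GRing.Theory Num.Theory.
Local Open Scope ring_scope.
Local Notation cofactor := Defs.cofactor.

(** * One-sided signs and one-sided Cauchy indices at a point *)

Section Germs.
Context {R : rcfType}.
Implicit Types (P Q D : {poly R}) (x : R) (e : bool).

Lemma poly_cofactorP P x : P != 0 ->
  exists m P', ~~ root P' x /\ P = ('X - x%:P) ^+ m * P'.
Proof.
move=> P0; have [m [q rq Pq]] := multiplicity_XsubC P x.
by exists m, q; split; [exact: implyP rq P0 | rewrite mulrC].
Qed.

Lemma mup_XsubC_exp m P x : ~~ root P x -> mup x (('X - x%:P) ^+ m * P) = m.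
Proof. by move=> rP; rewrite mupMl // mup_XsubCX eqxx. Qed.

Lemma cofactor_XsubC_exp m P x :
  ~~ root P x -> cofactor (('X - x%:P) ^+ m * P) x = P.
Proof.
move=> rP; rewrite /cofactor mup_XsubC_exp // mulKp //.
by rewrite expf_neq0 // polyXsubC_eq0.
Qed.

(* Sign of P just to the right (e = false) or just to the left (e = true)
   of x. *)
Definition gsign e P x : R :=
  (-1) ^+ (e * mup x P)%N * Num.sg (cofactor P x).[x].

Lemma gsign0 e x : gsign e 0 x = 0.
Proof. by rewrite /gsign /cofactor div0p horner0 sgr0 mulr0. Qed.

Lemma gsignE e m P x : ~~ root P x ->
  gsign e (('X - x%:P) ^+ m * P) x = (-1) ^+ (e * m)%N * Num.sg P.[x].
Proof. by move=> rP; rewrite /gsign mup_XsubC_exp // cofactor_XsubC_exp. Qed.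

Lemma gsign_Nroot e P x : ~~ root P x -> gsign e P x = Num.sg P.[x].
Proof. by move/(gsignE e 0); rewrite expr0 mul1r muln0 mul1r. Qed.

Lemma gsignM e P Q x : gsign e (P * Q) x = gsign e P x * gsign e Q x.
Proof.
have [->|P0] := eqVneq P 0; first by rewrite mul0r gsign0 mul0r.
have [->|Q0] := eqVneq Q 0; first by rewrite mulr0 gsign0 mulr0.
have [m [P' [rP ->]]] := poly_cofactorP _ x P0.
have [n [Q' [rQ ->]]] := poly_cofactorP _ x Q0.
rewrite mulrACA -exprD !gsignE ?rootM ?negb_or ?rP ?rQ //.
by rewrite mulnDr exprD hornerM sgrM; ring.
Qed.

Lemma gsignN e P x : gsign e (- P) x = - gsign e P x.
Proof.
rewrite -[- P]mulN1r gsignM gsign_Nroot ?rootN ?root1 //.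
by rewrite hornerN hornerC sgrN1 mulN1r.
Qed.

Lemma gsign_sqr e P x : P != 0 -> gsign e P x * gsign e P x = 1.
Proof.
move=> P0; have [m [P' [rP ->]]] := poly_cofactorP _ x P0.
by rewrite gsignE // mulrACA -expr2 sqrr_sign mul1r -expr2 sqr_sg -rootE rP.
Qed.

Lemma gsign_cases e P x :
  [\/ P = 0 /\ gsign e P x = 0, gsign e P x = 1 | gsign e P x = -1].
Proof.
have [->|P0] := eqVneq P 0; first by constructor 1; rewrite gsign0.
move: (gsign_sqr e P x P0); rewrite -expr2 => /eqP.
by rewrite sqrf_eq1 => /orP[] /eqP ->; [constructor 2 | constructor 3].
Qed.

(** If the orders at [x] differ, the term of lower order dominates; if they agree, the cofactors
    have values of the same sign at [x] and cannot cancel. *)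
Lemma gsignD e P Q x :
  gsign e P x = gsign e Q x -> gsign e (P + Q) x = gsign e P x.
Proof.
have [->|P0] := eqVneq P 0; first by rewrite add0r.
have [->|Q0] := eqVneq Q 0; first by rewrite addr0.
have [m [P' [rP ->]]] := poly_cofactorP _ x P0.
have [n [Q' [rQ ->]]] := poly_cofactorP _ x Q0.
wlog lemn : m n P' Q' rP rQ / (m <= n)%N.
  move=> H; have [lemn|/ltnW lenm E] := leqP m n; first exact: H.
  by rewrite (addrC (_ * P')) (H n m Q' P').
rewrite -(subnKC lemn) exprD -mulrA -mulrDr.
have [->|dn] := posnP (n - m).
  rewrite expr0 mul1r (gsignE _ _ P') // (gsignE _ _ Q') //.
  have s0 : (-1) ^+ (e * m) != 0 :> R by rewrite signr_eq0.
  move/(mulfI s0) => E.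
  have sPQ : Num.sg (P' + Q').[x] = Num.sg P'.[x].
    rewrite hornerD; move: E rP rQ; rewrite !rootE !neq_lt.
    move=> + /orP[] p /orP[] q; rewrite ?(ltr0_sg p) ?(gtr0_sg p);
      rewrite ?(ltr0_sg q) ?(gtr0_sg q) => E.
    - by rewrite ltr0_sg //; lra.
    - by exfalso; lra.
    - by exfalso; lra.
    - by rewrite gtr0_sg //; lra.
  by rewrite gsignE ?sPQ // rootE -sgr_eq0 sPQ sgr_eq0 -rootE.
move=> _; have sPQ : (P' + ('X - x%:P) ^+ (n - m) * Q').[x] = P'.[x].
  by rewrite !hornerE subrr expr0n gtn_eqF //= mul0r addr0.
by rewrite !gsignE ?sPQ // rootE sPQ -rootE.
Qed.

(* Twice Ind^+ (e = false) or Ind^- (e = true). *)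
Definition gind e P Q x : R :=
  if [&& P != 0, Q != 0 & (mup x P < mup x Q)%N]
  then gsign e P x * gsign e Q x else 0.

Lemma Ind_plusE P Q x : Ind_plus P Q x = gind false P Q x / 2%:R.
Proof.
rewrite /Ind_plus /gind /valp subr_lt0 ltz_nat.
by case: ifP => _; rewrite ?mul0r // /gsign !mul0n !expr0 !mul1r sgrM.
Qed.

Lemma Ind_minusE P Q x : Ind_minus P Q x = gind true P Q x / 2%:R.
Proof.
rewrite /Ind_minus /gind /valp subr_lt0 ltz_nat.
case: ifP => _; rewrite ?mul0r // /gsign !mul1n mulrACA -exprD sgrM.
(* The exponent is an integer difference; as [-1] is its own inverse, only its parity matters, which
   is that of the sum. *)
congr (_ * _ / _); rewrite expfzDr ?oppr_eq0 ?oner_eq0 // -exprnP exprD.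
by rewrite -exprnN -exprVn invrN1.
Qed.

Lemma gind0l e Q x : gind e 0 Q x = 0.
Proof. by rewrite /gind eqxx. Qed.

Lemma gind0r e P x : gind e P 0 x = 0.
Proof. by rewrite /gind eqxx andbF. Qed.

Lemma gindNr e P Q x : gind e P (- Q) x = - gind e P Q x.
Proof.
rewrite /gind oppr_eq0 gsignN -[- Q]mulN1r mupMr ?rootN ?root1 //.
by case: ifP; rewrite ?oppr0 // mulrN.
Qed.

(** A common factor shifts both multiplicities equally and enters the sign product squared. *)
Lemma gind_mul e D P Q x : D != 0 -> gind e (D * P) (D * Q) x = gind e P Q x.
Proof.
move=> D0; rewrite /gind !mulf_eq0 !negb_or D0 /=.
have [->|P0 /=] := eqVneq P 0; first by [].
have [->|Q0 /=] := eqVneq Q 0; first by [].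
by rewrite !mupM // ltn_add2l !gsignM mulrACA gsign_sqr // mul1r.
Qed.

Lemma gind_Nroot e P Q x : ~~ root Q x -> gind e P Q x = 0.
Proof. by move=> rQ; rewrite /gind (mupNroot rQ) ltn0 !andbF. Qed.

Lemma gind_root e P Q x : ~~ root P x -> root Q x ->
  gind e P Q x = Num.sg P.[x] * gsign e Q x.
Proof.
move=> rP rQ; rewrite /gind (mupNroot rP).
have P0 : P != 0 by apply: contraNneq rP => ->; rewrite root0.
have [->|Q0] := eqVneq Q 0; first by rewrite gsign0 !mulr0 andbF.
by rewrite P0 /= -XsubC_dvd // dvdp_XsubCl rQ gsign_Nroot.
Qed.

End Germs.

(** * The local defect of additivity under complex multiplication *)

Section ProductFormula.
Context {R : rcfType}.
Implicit Types (D P Q U V : {poly R}) (x : R) (e : bool).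

(** With [H = P + iQ] and [K = U + iV], the first [gind] belongs to [H K]. The sign term is the
    correction that makes the value equal on both sides of [x] for nonzero [H] and [K]. *)
Definition mul_defect e P Q U V x : R :=
  gind e (P * U - Q * V) (P * V + Q * U) x - gind e P Q x - gind e U V x
  + gsign e (P * V + Q * U) x * gsign e Q x * gsign e V x.

(** Case split on whether [Q] and [V] vanish at [x]. The point is that the right-hand side is free
    of [e]. *)
Lemma mul_defect_coprime e P Q U V x :
  ~~ (root P x && root Q x) -> ~~ (root U x && root V x) ->
  mul_defect e P Q U V x = Num.sg ((P * V + Q * U).[x] * Q.[x] * V.[x]).
Proof.
move=> rPQ rUV; rewrite /mul_defect.
have sgK (y : R) : y != 0 -> Num.sg y * Num.sg y = 1.
  by move=> y0; rewrite -expr2 sqr_sg y0.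
case rQ: (root Q x) rPQ; case rV: (root V x) rUV; rewrite ?andbT ?andbF.
- move=> rU rP; have rN : root (P * V + Q * U) x.
    by rewrite rootE hornerD !hornerM (rootP rQ) (rootP rV) mulr0 mul0r addr0.
  have sM : (P * U - Q * V).[x] = P.[x] * U.[x].
    by rewrite !(hornerD, hornerN, hornerM) (rootP rQ) mul0r subr0.
  have rM : ~~ root (P * U - Q * V) x.
    by rewrite rootE sM mulf_neq0 -?rootE.
  rewrite !gind_root // sM sgrM (rootP rQ) mulr0 mul0r sgr0.
  have sP := gsign_Nroot e P x rP; have sU := gsign_Nroot e U x rU.
  have P0 : P != 0 by apply: contraNneq rP => ->; rewrite root0.
  have U0 : U != 0 by apply: contraNneq rU => ->; rewrite root0.
  have pp := gsign_sqr e P x P0; have uu := gsign_sqr e U x U0.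
  rewrite -sP -sU.
  (* Let [p, q, u, v] be the four one-sided signs. If [p v = q u], this is the sign of the sum. If
     [p v = - q u] with both nonzero, then [p u = - q v] and everything cancels whatever the sign of
     the sum is. If just one of [Q], [V] is zero, the sum is a single product. *)
  have sN : gsign e (P * V) x = gsign e (Q * U) x ->
      gsign e (P * V + Q * U) x = gsign e P x * gsign e V x.
    by move/gsignD ->; rewrite gsignM.
  move: sN; rewrite !gsignM.
  have sgn y : y * y = 1 -> y = 1 \/ y = -1 :> R.
    by move=> /eqP; rewrite -expr2 sqrf_eq1 => /orP[] /eqP; [left | right].
  case: (sgn _ pp) => p; case: (sgn _ uu) => u;
    case: (gsign_cases e Q x) => [[Q0 q]|q|q];
    case: (gsign_cases e V x) => [[V0 v]|v|v];
    try rewrite Q0; try rewrite V0;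
    rewrite ?mul0r ?mulr0 ?addr0 ?add0r ?gsignM ?gsign0 ?p ?q ?u ?v => sN;
    first [by ring | by rewrite sN; ring].
(* Only [Q] vanishes: the sum has the sign of [P V] at [x], so the sign product cancels
   [gind e P Q x]. The next case is symmetric. *)
- move=> rU rP; have sN : (P * V + Q * U).[x] = P.[x] * V.[x].
    by rewrite hornerD !hornerM (rootP rQ) mul0r addr0.
  have rN : ~~ root (P * V + Q * U) x.
    by rewrite rootE sN mulf_neq0 -?rootE ?rV.
  rewrite (gind_Nroot _ _ _ _ rN) (gind_Nroot _ _ V) ?rV // gind_root //.
  rewrite !(gsign_Nroot _ (P * V + Q * U)) // (gsign_Nroot _ V) ?rV //.
  rewrite sN (rootP rQ) mulr0 mul0r sgr0 sgrM.
  have V0 : V.[x] != 0 by rewrite -rootE rV.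
  rewrite !subr0 sub0r mulrAC -[X in _ + X]mulrA [X in _ + X]mulrAC.
  transitivity (Num.sg P.[x] * gsign e Q x * (Num.sg V.[x] * Num.sg V.[x] - 1)).
    by ring.
  by rewrite sgK // subrr mulr0.
- move=> rU rP; have sN : (P * V + Q * U).[x] = Q.[x] * U.[x].
    by rewrite hornerD !hornerM (rootP rV) mulr0 add0r.
  have rN : ~~ root (P * V + Q * U) x.
    by rewrite rootE sN mulf_neq0 -?rootE ?rQ.
  rewrite (gind_Nroot _ _ _ _ rN) (gind_Nroot _ _ Q) ?rQ // gind_root //.
  rewrite !(gsign_Nroot _ (P * V + Q * U)) // (gsign_Nroot _ Q) ?rQ //.
  rewrite sN (rootP rV) mulr0 sgr0 sgrM.
  have Q0 : Q.[x] != 0 by rewrite -rootE rQ.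
  transitivity (Num.sg U.[x] * gsign e V x * (Num.sg Q.[x] * Num.sg Q.[x] - 1)).
    by ring.
  by rewrite sgK // subrr mulr0.
- move=> _ _; rewrite (gind_Nroot _ _ Q) ?rQ // (gind_Nroot _ _ V) ?rV //.
  rewrite (gsign_Nroot _ Q) ?rQ // (gsign_Nroot _ V) ?rV // !subr0.
  case rN: (root (P * V + Q * U) x); last first.
    by rewrite gind_Nroot ?rN // gsign_Nroot ?rN // add0r !sgrM.
  have Q0 : Q.[x] != 0 by rewrite -rootE rQ.
  have V0 : V.[x] != 0 by rewrite -rootE rV.
  have N0 : P.[x] * V.[x] = - (Q.[x] * U.[x]).
    by apply/eqP; rewrite -addr_eq0 -!hornerM -hornerD; exact: rN.
  (* At a common zero of P V + Q U, the product (P U - Q V) Q V equals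
     - (Q U)^2 - (Q V)^2. *)
  have M0 : (P.[x] * U.[x] - Q.[x] * V.[x]) * (Q.[x] * V.[x]) < 0.
    have -> : (P.[x] * U.[x] - Q.[x] * V.[x]) * (Q.[x] * V.[x])
      = (P.[x] * V.[x]) * (Q.[x] * U.[x]) - (Q.[x] * V.[x]) ^+ 2 by ring.
    rewrite N0 mulNr -expr2 -opprD oppr_lt0 ltr_wpDl ?sqr_ge0 //.
    by rewrite exprn_even_gt0 //= mulf_neq0.
  have sM : (P * U - Q * V).[x] = P.[x] * U.[x] - Q.[x] * V.[x].
    by rewrite !(hornerD, hornerN, hornerM).
  have rM : ~~ root (P * U - Q * V) x.
    by rewrite rootE sM; move: M0; apply: contraTneq => ->; rewrite mul0r ltxx.
  rewrite gind_root // (rootP rN) !mul0r sgr0 sM.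
  set m := _ - _ in M0 *.
  (* Since [m] and [Q V] have opposite signs, the index of the product cancels the sign term. *)
  have sE : Num.sg m = - (Num.sg Q.[x] * Num.sg V.[x]).
    have : Num.sg m * (Num.sg Q.[x] * Num.sg V.[x]) = -1.
      by rewrite -!sgrM ltr0_sg.
    have q1 := sgK _ Q0; have v1 := sgK _ V0 => E.
    rewrite -[LHS]mulr1 -v1 -[Num.sg m]mulr1 -q1.
    transitivity (Num.sg m * (Num.sg Q.[x] * Num.sg V.[x])
      * (Num.sg Q.[x] * Num.sg V.[x])); first by ring.
    by rewrite E mulN1r.
  by rewrite sE; ring.
Qed.

(** Each of [D] and [E] enters the triple sign product twice, hence as a square; the indices ignore
    common factors by [gind_mul]. *)
Lemma mul_defect_mul e D E P Q U V x : D != 0 -> E != 0 ->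
  mul_defect e (D * P) (D * Q) (E * U) (E * V) x = mul_defect e P Q U V x.
Proof.
move=> D0 E0; rewrite /mul_defect.
have -> : D * P * (E * U) - D * Q * (E * V) = D * E * (P * U - Q * V) by ring.
have -> : D * P * (E * V) + D * Q * (E * U) = D * E * (P * V + Q * U) by ring.
rewrite !gind_mul ?mulf_neq0 // !gsignM; congr (_ + _).
rewrite -[RHS]mulr1 -(gsign_sqr e D x D0) -[RHS]mulr1 -(gsign_sqr e E x E0).
by ring.
Qed.

Lemma XsubC_exp_coprime P Q x : (P != 0) || (Q != 0) ->
  exists m P' Q', [/\ P = ('X - x%:P) ^+ m * P', Q = ('X - x%:P) ^+ m * Q'
    & ~~ (root P' x && root Q' x)].
Proof.
have [-> /= Q0|P0 _] := eqVneq P 0.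
  have [m [Q' [rQ EQ]]] := poly_cofactorP _ x Q0.
  by exists m, 0, Q'; rewrite mulr0 negb_and rQ orbT.
have [m [P' [rP EP]]] := poly_cofactorP _ x P0.
have [->|Q0] := eqVneq Q 0.
  by exists m, P', 0; rewrite mulr0 negb_and rP.
have [n [Q' [rQ EQ]]] := poly_cofactorP _ x Q0.
have [lemn|/ltnW lenm] := leqP m n.
  exists m, P', (('X - x%:P) ^+ (n - m) * Q').
  by rewrite mulrA -exprD subnKC // negb_and rP.
exists n, (('X - x%:P) ^+ (m - n) * P'), Q'.
by rewrite mulrA -exprD subnKC // negb_and rQ orbT.
Qed.

(** Stripping the common powers of ['X - x%:P] reduces to [mul_defect_coprime]. In this way common
    zeros inside an interval are allowed. *)
Lemma mul_defect_sides P Q U V x :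
  (P != 0) || (Q != 0) -> (U != 0) || (V != 0) ->
  mul_defect false P Q U V x = mul_defect true P Q U V x.
Proof.
move=> /(XsubC_exp_coprime _ _ x)[m [P' [Q' [-> -> rPQ]]]].
move=> /(XsubC_exp_coprime _ _ x)[n [U' [V' [-> -> rUV]]]].
by rewrite !mul_defect_mul ?expf_neq0 ?polyXsubC_eq0 // !mul_defect_coprime.
Qed.

End ProductFormula.

(** * From local signs to Cauchy indices on intervals *)

Section Telescoping.
Context {R : rcfType}.
Implicit Types (D P Q U V M : {poly R}) (a b x : R) (e : bool) (s : seq R).

(** Split off the powers of ['X - a%:P] and ['X - b%:P]. The remaining factor keeps its sign on
    [[a, b]], and the power of ['X - b%:P] contributes [(-1) ^+ n] at both ends. *)
Lemma gsign_itv M a b : a < b ->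
  (forall x, a < x < b -> M != 0 -> ~~ root M x) ->
  gsign false M a = gsign true M b.
Proof.
move=> ab; have [->|M0 rM] := eqVneq M 0; first by rewrite !gsign0.
have [m [M1 [rM1 EM1]]] := poly_cofactorP M a M0.
have M10 : M1 != 0 by apply: contraNneq rM1 => ->; rewrite root0.
have [n [M2 [rM2 EM2]]] := poly_cofactorP M1 b M10.
have EM : M = ('X - b%:P) ^+ n * (('X - a%:P) ^+ m * M2).
  by rewrite EM1 EM2 mulrCA.
have ba0 : b - a != 0 by rewrite subr_eq0 gt_eqF.
have M2b : ~~ root (('X - a%:P) ^+ m * M2) b.
  by rewrite rootE !hornerE mulf_neq0 // expf_neq0.
rewrite [in RHS]EM EM1 !gsignE // EM2 !hornerE !sgrM !sgrX.
rewrite (gtr0_sg (_ : 0 < b - a)) ?subr_gt0 // ltr0_sg ?subr_lt0 //.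
rewrite expr1n mul1r; congr (_ * _).
apply: (@polyrN0_itv _ `[a, b]); rewrite ?in_itv /= ?lexx ?ltW //.
move=> x; rewrite in_itv /= => /andP[]; rewrite le_eqVlt => /orP[/eqP<- _|ax].
  by move: rM1; rewrite EM2 rootM negb_or => /andP[].
rewrite le_eqVlt => /orP[/eqP-> //|xb].
by move: (rM x); rewrite ax xb EM !rootM !negb_or => /(_ isT isT) /and3P[].
Qed.

(** By [gsign_itv] the signs at the two ends of each gap between consecutive points agree, so
    regrouping the sum by gaps gives zero. *)
Lemma gsign_telescope M s a b : path <%R a (rcons s b) ->
  (forall x, a < x < b -> M != 0 -> root M x -> x \in s) ->
  gsign false M a - gsign true M b
  + \sum_(x <- s) (gsign false M x - gsign true M x) = 0.
Proof.
elim: s a => [|c s IHs] a /=.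
  rewrite andbT => ab rM; rewrite big_nil addr0; apply/eqP.
  by rewrite subr_eq0 (gsign_itv M _ b) // => x axb M0; apply/negP => /(rM x axb M0).
move=> /andP[ac cs] rM; rewrite big_cons.
have cb : c < b.
  by move: cs; rewrite lt_path_sortedE => /andP[/allP/(_ b)]; rewrite mem_rcons mem_head => ->.
have /= E := IHs _ cs; rewrite -[RHS]E => [|x /andP[cx xb] M0 rx].
  rewrite (gsign_itv M a c) // => [|x /andP[ax xc] M0]; first by ring.
  apply/negP => /rM; rewrite ax (lt_trans xc cb) => /(_ isT M0).
  rewrite inE lt_eqF //= => xs; move: cs.
  rewrite lt_path_sortedE => /andP[/allP/(_ x)].
  by rewrite mem_rcons inE xs orbT => /(_ isT); rewrite ltNge ltW.
have := rM x; rewrite (lt_trans ac cx) xb => /(_ isT M0 rx).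
by rewrite inE gt_eqF.
Qed.

(** Points of [s] that are not roots of [Q] contribute zero, so the indices of several pairs can be
    written over one list. *)
Lemma Ind_ltE a b P Q s : uniq s -> (forall x, x \in s -> a < x < b) ->
  (forall x, a < x < b -> Q != 0 -> root Q x -> x \in s) ->
  Ind_lt a b P Q = (gind false P Q a - gind true P Q b
    + \sum_(x <- s) (gind false P Q x - gind true P Q x)) / 2%:R.
Proof.
move=> us sab rs; rewrite /Ind_lt Ind_plusE Ind_minusE.
have -> : \sum_(x <- roots Q a b) Ind_pt P Q x
   = (\sum_(x <- s) (gind false P Q x - gind true P Q x)) / 2%:R; last by ring.
rewrite mulr_suml; have [->|Q0] := eqVneq Q 0.
  by rewrite roots0 big_nil big1 // => x _; rewrite !gind0r subr0 mul0r.
rewrite [RHS](bigID (root Q)) /= [X in _ + X]big1 => [|x rx]; last first.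
  by rewrite !gind_Nroot // subr0 mul0r.
rewrite addr0 -[RHS]big_filter (perm_big [seq x <- s | root Q x]) /=.
  by apply: eq_bigr => x _; rewrite /Ind_pt Ind_plusE Ind_minusE mulrBl.
apply: uniq_perm; rewrite ?uniq_roots ?filter_uniq // => x; rewrite mem_filter.
apply/idP/andP => [xr|[rx xs]].
  have rx := root_roots xr; split=> //; apply: rs => //.
  by have := roots_in xr; rewrite in_itv.
by apply: root_in_roots => //; rewrite in_itv /= sab.
Qed.

(** Only nonzero members enter the product: a zero factor would make it zero, and its list [roots]
    empty. *)
Lemma roots_of_seq a b (Ps : seq {poly R}) : a < b -> exists s,
  [/\ path <%R a (rcons s b), forall x, x \in s -> a < x < b
    & forall P x, P \in Ps -> a < x < b -> P != 0 -> root P x -> x \in s].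
Proof.
move=> ab; pose B := \prod_(P <- Ps | P != 0) P.
have B0 : B != 0 by rewrite prodf_seq_neq0; apply/allP => P _; apply/implyP.
exists (roots B a b); split=> [|x /roots_in|P x PP axb P0 rx].
- rewrite lt_path_sortedE; apply/andP; split.
    apply/allP => x; rewrite mem_rcons inE => /orP[/eqP-> //|/roots_in].
    by rewrite in_itv /= => /andP[].
  rewrite -cats1 sorted_pairwise ?pairwise_cat; last exact: lt_trans.
  rewrite -(sorted_pairwise lt_trans) sorted_roots /= allrel1r !andbT.
  by apply/allP => x /roots_in; rewrite in_itv /= => /andP[].
- by rewrite in_itv.
apply: root_in_roots => //.
rewrite /B (big_rem P) //= P0 rootM rx //.
Qed.

(** Equality of the defects on both sides of each inner point turns the failure of additivity into
    jumps of the sign of [N * Q * V], and these telescope. *)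
Lemma Ind_lt_mul a b P Q U V : a < b ->
  ~~ (root P a && root Q a) -> ~~ (root U a && root V a) ->
  ~~ (root P b && root Q b) -> ~~ (root U b && root V b) ->
  Ind_lt a b (P * U - Q * V) (P * V + Q * U) =
  Ind_lt a b P Q + Ind_lt a b U V
  + (Num.sg ((P * V + Q * U).[a] * Q.[a] * V.[a])
     - Num.sg ((P * V + Q * U).[b] * Q.[b] * V.[b])) / 2%:R.
Proof.
move=> ab PQa UVa PQb UVb; set N := P * V + Q * U; set K := _ - _.
have [s [ps sab rs]] := roots_of_seq a b [:: N; Q; V] ab.
have us : uniq s.
  have := path_sorted ps; move/(sorted_uniq lt_trans ltxx).
  by rewrite rcons_uniq => /andP[].
have PQ0 : (P != 0) || (Q != 0).
  by rewrite -negb_and; apply: contra PQa => /andP[/eqP-> /eqP->]; rewrite root0.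
have UV0 : (U != 0) || (V != 0).
  by rewrite -negb_and; apply: contra UVa => /andP[/eqP-> /eqP->]; rewrite root0.
rewrite !(Ind_ltE _ _ _ _ s) // => [|x|x|x];
  try by apply: rs; rewrite !inE eqxx ?orbT.
have := gsign_telescope (N * Q * V) s a b ps.
have /[swap]/[apply] T : forall x, a < x < b -> N * Q * V != 0 ->
    root (N * Q * V) x -> x \in s.
  move=> x axb; rewrite !mulf_eq0 !negb_or !rootM => /andP[/andP[N0 Q0] V0].
  by move=> /orP[/orP[]|]; apply: rs; rewrite // !inE eqxx ?orbT.
(* At the end points coprimality gives the defect in closed form; at inner points only its
   independence of the side is used. *)
have Da e := mul_defect_coprime e P Q U V a PQa UVa.
have Db e := mul_defect_coprime e P Q U V b PQb UVb.
have Ds x := mul_defect_sides P Q U V x PQ0 UV0.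
move: (Da false) (Db true); rewrite /mul_defect -/N -/K => <- <-.
rewrite -!mulrDl; congr (_ / _).
have -> : \sum_(x <- s) (gind false K N x - gind true K N x)
  = \sum_(x <- s) (gind false P Q x - gind true P Q x)
  + \sum_(x <- s) (gind false U V x - gind true U V x)
  - \sum_(x <- s) (gsign false (N * Q * V) x - gsign true (N * Q * V) x).
  rewrite -big_split -sumrB; apply: eq_bigr => x _ /=.
  have := Ds x; rewrite /mul_defect -/N -/K !gsignM => E.
  apply/eqP; rewrite -subr_eq0; move/eqP: E; rewrite -subr_eq0 => /eqP <-.
  by apply/eqP; ring.
move: T; set S := \sum_(x <- s) (gsign _ _ _ - _); rewrite !gsignM => T.
have -> : S = gsign true N b * gsign true Q b * gsign true V b
  - gsign false N a * gsign false Q a * gsign false V a.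
  by apply/eqP; rewrite -subr_eq0 -T; apply/eqP; ring.
by ring.
Qed.

Lemma Ind_mul a b P Q U V :
  ~~ (root P a && root Q a) -> ~~ (root U a && root V a) ->
  ~~ (root P b && root Q b) -> ~~ (root U b && root V b) ->
  Ind a b (P * U - Q * V) (P * V + Q * U) =
  Ind a b P Q + Ind a b U V
  + (Num.sg ((P * V + Q * U).[a] * Q.[a] * V.[a])
     - Num.sg ((P * V + Q * U).[b] * Q.[b] * V.[b])) / 2%:R.
Proof.
move=> PQa UVa PQb UVb; rewrite /Ind; case: ltgtP => [ab|ba|<-].
- exact: Ind_lt_mul.
- by rewrite Ind_lt_mul //; ring.
- by ring.
Qed.

(** Pointwise this is [gind_mul]; the common list absorbs the extra roots that [D] brings in. *)
Lemma Ind_mull a b D P Q : D != 0 -> Ind a b (D * P) (D * Q) = Ind a b P Q.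
Proof.
move=> D0; suff H u v : u < v -> Ind_lt u v (D * P) (D * Q) = Ind_lt u v P Q.
  by rewrite /Ind; case: ltgtP => // [/H|/H ->].
move=> uv; have [s [ps sab rs]] := roots_of_seq u v [:: D * Q; Q] uv.
have us : uniq s.
  have := path_sorted ps; move/(sorted_uniq lt_trans ltxx).
  by rewrite rcons_uniq => /andP[].
rewrite !(Ind_ltE _ _ _ _ s) // => [|x|x];
  try by apply: rs; rewrite !inE eqxx ?orbT.
rewrite !gind_mul //; congr ((_ + _) / _).
by apply: eq_bigr => x _; rewrite !gind_mul.
Qed.

Lemma IndNr a b P Q : Ind a b P (- Q) = - Ind a b P Q.
Proof.
suff H u v : Ind_lt u v P (- Q) = - Ind_lt u v P Q.
  by rewrite /Ind; case: ltgtP => _; rewrite ?H ?oppr0.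
rewrite /Ind_lt roots_opp /Ind_pt Ind_plusE Ind_minusE.
rewrite (eq_bigr (fun x => - (Ind_plus P Q x - Ind_minus P Q x))) => [|x _].
  by rewrite sumrN Ind_plusE Ind_minusE !gindNr; ring.
by rewrite !Ind_plusE !Ind_minusE !gindNr; ring.
Qed.

Lemma IndC a b P Q : Ind a b P Q = - Ind b a P Q.
Proof. by rewrite /Ind; case: ltgtP => _; rewrite ?opprK ?oppr0. Qed.

End Telescoping.

(** * Cauchy indices of complex polynomial paths *)

Section ComplexPaths.
Context {R : rcfType}.
Implicit Types (H K : {poly R[i]}) (D : {poly R}) (a b : R).

Definition pathInd a b H : R := Ind a b (repoly H) (impoly H).

Lemma coef_repoly H i : (repoly H)`_i = complex.Re H`_i.
Proof. by rewrite coef_map_id0. Qed.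

Lemma coef_impoly H i : (impoly H)`_i = complex.Im H`_i.
Proof. by rewrite coef_map_id0. Qed.

Lemma ReD (z w : R[i]) : complex.Re (z + w) = complex.Re z + complex.Re w.
Proof. by case: z w => [? ?] []. Qed.

Lemma ImD (z w : R[i]) : complex.Im (z + w) = complex.Im z + complex.Im w.
Proof. by case: z w => [? ?] []. Qed.

Lemma ReM (z w : R[i]) : complex.Re (z * w) =
  complex.Re z * complex.Re w - complex.Im z * complex.Im w.
Proof. by case: z w => [? ?] []. Qed.

Lemma ImM (z w : R[i]) : complex.Im (z * w) =
  complex.Re z * complex.Im w + complex.Im z * complex.Re w.
Proof. by case: z w => [? ?] []. Qed.

Lemma repolyM H K :
  repoly (H * K) = repoly H * repoly K - impoly H * impoly K.
Proof.
apply/polyP => n; rewrite coefB coef_repoly !coefM (big_morph _ ReD erefl).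
rewrite -sumrB; apply: eq_bigr => j _.
by rewrite !coef_repoly !coef_impoly ReM.
Qed.

Lemma impolyM H K :
  impoly (H * K) = repoly H * impoly K + impoly H * repoly K.
Proof.
apply/polyP => n; rewrite coefD coef_impoly !coefM (big_morph _ ImD erefl).
rewrite -big_split; apply: eq_bigr => j _ /=.
by rewrite !coef_repoly !coef_impoly ImM.
Qed.

Lemma repoly_real D : repoly (map_poly (real_complex R) D) = D.
Proof. by apply/polyP => n; rewrite coef_repoly coef_map. Qed.

Lemma impoly_real D : impoly (map_poly (real_complex R) D) = 0.
Proof. by apply/polyP => n; rewrite coef_impoly coef_map coef0. Qed.

Lemma repoly_conj H : repoly (map_poly (@conjc R) H) = repoly H.
Proof.
by apply/polyP => n; rewrite !coef_repoly coef_map /=; case: (H`_n).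
Qed.

Lemma impoly_conj H : impoly (map_poly (@conjc R) H) = - impoly H.
Proof.
by apply/polyP => n; rewrite coefN !coef_impoly coef_map /=; case: (H`_n).
Qed.

Lemma eq_reim_poly H K : repoly H = repoly K -> impoly H = impoly K -> H = K.
Proof.
move=> /polyP rHK /polyP iHK; apply/polyP => n; apply/eqP.
by rewrite eq_complex -!coef_repoly -!coef_impoly rHK iHK !eqxx.
Qed.

Lemma reim_polyE H : H = map_poly (real_complex R) (repoly H)
  + (Complex 0 1)%:P * map_poly (real_complex R) (impoly H).
Proof.
apply/polyP => n; rewrite coefD coefCM !coef_map /= ?coef_repoly ?coef_impoly.
by rewrite -complexE.
Qed.

Lemma horner_real D a :
  (map_poly (real_complex R) D).[Complex a 0] = Complex D.[a] 0.
Proof. exact: horner_map. Qed.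

Lemma horner_reim H a :
  H.[Complex a 0] = Complex (repoly H).[a] (impoly H).[a].
Proof.
rewrite [in LHS](reim_polyE H) hornerD hornerM hornerC !horner_real.
by apply/eqP; rewrite eq_complex /=; apply/andP; split; apply/eqP; ring.
Qed.

Lemma horner_conj H a :
  (map_poly (@conjc R) H).[Complex a 0] = conjc H.[Complex a 0].
Proof.
by rewrite !horner_reim repoly_conj impoly_conj hornerN.
Qed.

Lemma reim_coprime H a : H.[Complex a 0] != 0 ->
  ~~ (root (repoly H) a && root (impoly H) a).
Proof.
rewrite horner_reim; apply: contra => /andP[/rootP -> /rootP ->].
exact: eqxx.
Qed.

(** It depends only on the values of the two paths, so two edges meeting at a vertex produce the
    same term there. *)
Definition cocycle (z w : R[i]) : R :=
  Num.sg (complex.Im (z * w) * complex.Im z * complex.Im w).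

Lemma pathInd_mul a b H K :
  H.[Complex a 0] != 0 -> K.[Complex a 0] != 0 ->
  H.[Complex b 0] != 0 -> K.[Complex b 0] != 0 ->
  pathInd a b (H * K) = pathInd a b H + pathInd a b K
  + (cocycle H.[Complex a 0] K.[Complex a 0]
     - cocycle H.[Complex b 0] K.[Complex b 0]) / 2%:R.
Proof.
move=> Ha Ka Hb Kb; rewrite /pathInd repolyM impolyM Ind_mul ?reim_coprime //.
by rewrite /cocycle !horner_reim !ImM /= !hornerD !hornerM.
Qed.

(** [H] times its conjugate has zero imaginary part, so it is a nonzero real polynomial and
    [Ind_mull] removes it. *)
Lemma pathInd_normM a b H K : H != 0 ->
  pathInd a b (H * map_poly (@conjc R) H * K) = pathInd a b K.
Proof.
move=> H0; set N := H * _; set D := repoly N.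
have iN : impoly N = 0.
  by rewrite impolyM repoly_conj impoly_conj mulrN addrC mulrC subrr.
have EN : N = map_poly (real_complex R) D.
  by apply: eq_reim_poly; rewrite ?repoly_real ?impoly_real.
have D0 : D != 0.
  have : N != 0.
    rewrite mulf_neq0 // map_poly_eq0_id0 ?lead_coef_eq0 //.
    by rewrite conjc_eq0 lead_coef_eq0.
  by apply: contraNneq => D0; rewrite EN D0 rmorph0.
rewrite /pathInd repolyM impolyM iN mul0r subr0 mul0r addr0.
exact: Ind_mull.
Qed.

Lemma pathInd_conj a b H : pathInd a b (map_poly (@conjc R) H) = - pathInd a b H.
Proof. by rewrite /pathInd repoly_conj impoly_conj IndNr. Qed.

Lemma pathIndC a b H : pathInd a b H = - pathInd b a H.
Proof. exact: IndC. Qed.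

Lemma IndCr a b (P : {poly R}) (c : R) : Ind a b P c%:P = 0.
Proof.
have H e x : gind e P c%:P x = 0.
  have [->|c0] := eqVneq c 0; first by rewrite gind0r.
  by rewrite gind_Nroot // rootC.
by rewrite /Ind /Ind_lt !Ind_plusE !Ind_minusE !rootsC !big_nil !H; case: ltgtP => _;
  rewrite ?mul0r ?addr0 ?subr0 ?oppr0.
Qed.

(** One-dimensional counterpart of [cGamma]. *)
Definition itv_weight a b (v : R) : R :=
  if a < v < b then 1 else if (v == a) || (v == b) then 2%:R^-1 else 0.

(** Each side of the pole [v] contributes half of [Num.sg c], the left side through the minus sign
    in front of [Ind_minus]. An inner point collects both halves, an end point one. *)
Lemma Ind_constXsubC a b (c v : R) : a < b ->
  Ind a b c%:P ('X - v%:P) = Num.sg c * itv_weight a b v.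
Proof.
move=> ab; rewrite /Ind ab.
have E e x : gind e c%:P ('X - v%:P) x =
    if x == v then (-1) ^+ e * Num.sg c else 0.
  have [->|c0] := eqVneq c 0; first by rewrite gind0l sgr0 mulr0 if_same.
  case: eqVneq => [->|xv]; last by rewrite gind_Nroot // root_XsubC.
  rewrite gind_root ?rootC ?root_XsubC // hornerC mulrC.
  have := gsignE e 1 1 v; rewrite mulr1 expr1 => ->; last exact: root1.
  by rewrite hornerC sgr1 mulr1 muln1.
have [avb|avb] := boolP (a < v < b).
  rewrite (Ind_ltE _ _ _ _ [:: v]) // => [|x|x _ _]; last first.
  - by rewrite root_XsubC inE.
  - by rewrite inE => /eqP ->.
  rewrite big_seq1 !E eqxx /itv_weight avb.
  case/andP: avb => av vb; rewrite (lt_eqF av) (gt_eqF vb) expr0 expr1.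
  by field.
rewrite (Ind_ltE _ _ _ _ [::]) // => [|x axb _]; last first.
  by rewrite root_XsubC => /eqP xv; rewrite xv (negPf avb) in axb.
rewrite big_nil !E /itv_weight (negPf avb) ![v == _]eq_sym.
have [av|_] := eqVneq a v.
  by rewrite -av (gt_eqF ab) /= expr0; field.
by case: eqVneq => _; rewrite /= ?expr1; field.
Qed.

End ComplexPaths.

(** * Winding numbers around a rectangle *)

Section Winding.
Context {R : rcfType}.
Implicit Types (F G A : {poly R[i]}) (z : R[i]).

Lemma windE F G (x0 x1 y0 y1 : R) : wind F G x0 x1 y0 y1 = 2%:R^-1 *
  (pathInd x0 x1 (hprod F G y0) + pathInd y0 y1 (vprod F G x1)
   + pathInd x1 x0 (hprod F G y1) + pathInd y1 y0 (vprod F G x0)).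
Proof. by []. Qed.

Lemma horner_hrestr F (x y : R) : (hrestr F y).[Complex x 0] = F.[Complex x y].
Proof.
rewrite /hrestr horner_comp !hornerE; congr _.[_].
by apply/eqP; rewrite eq_complex /= addr0 add0r !eqxx.
Qed.

Lemma horner_vrestr F (x y : R) : (vrestr F x).[Complex y 0] = F.[Complex x y].
Proof.
rewrite /vrestr horner_comp !hornerE; congr _.[_].
by apply/eqP; rewrite eq_complex /=; apply/andP; split; apply/eqP; ring.
Qed.

Lemma hprod1 F (y : R) : hprod F 1 y = hrestr F y.
Proof. by rewrite /hprod /hrestr comp_polyC rmorph1 mulr1. Qed.

Lemma vprod1 F (x : R) : vprod F 1 x = vrestr F x.
Proof. by rewrite /vprod /vrestr comp_polyC rmorph1 mulr1. Qed.

Lemma hrestrM F G (y : R) : hrestr (F * G) y = hrestr F y * hrestr G y.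
Proof. exact: comp_polyM. Qed.

Lemma vrestrM F G (x : R) : vrestr (F * G) x = vrestr F x * vrestr G x.
Proof. exact: comp_polyM. Qed.

Lemma hrestr_neq0 F (y : R) : F != 0 -> hrestr F y != 0.
Proof.
move=> F0; rewrite /hrestr comp_poly_eq0 //.
by rewrite -[Complex 0 y]opprK polyCN size_XsubC.
Qed.

Lemma vrestr_neq0 F (x : R) : F != 0 -> vrestr F x != 0.
Proof.
move=> F0; rewrite /vrestr comp_poly_eq0 // addrC mul_polyC.
have i0 : Complex 0 1 != 0 :> R[i] by rewrite eq_complex /= oner_eq0 andbF.
by rewrite size_polyDl size_scale ?size_polyX // ltnS size_polyC_leq1.
Qed.

(** On each edge the path is multiplied by the squared norm of [A], a nonzero real polynomial. This
    disposes of the vertex zeros shared by [F] and [G]. *)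
Lemma wind_cancel A F G (x0 x1 y0 y1 : R) : A != 0 ->
  wind (A * F) (A * G) x0 x1 y0 y1 = wind F G x0 x1 y0 y1.
Proof.
move=> A0; rewrite !windE.
have hE y : hprod (A * F) (A * G) y =
    hrestr A y * map_poly (@conjc R) (hrestr A y) * hprod F G y.
  by rewrite /hprod !hrestrM rmorphM mulrACA.
have vE x : vprod (A * F) (A * G) x =
    vrestr A x * map_poly (@conjc R) (vrestr A x) * vprod F G x.
  by rewrite /vprod !vrestrM rmorphM mulrACA.
by rewrite !hE !vE !pathInd_normM ?hrestr_neq0 ?vrestr_neq0.
Qed.

Definition vertices (x0 x1 y0 y1 : R) : seq R[i] :=
  [:: Complex x0 y0; Complex x1 y0; Complex x1 y1; Complex x0 y1].

(** The [p] and [q] are edge indices of two factors, the [k] are values of [cocycle] at the vertices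
    in order of traversal; each [k] occurs once with either sign. *)
Lemma half_telescope (p1 p2 p3 p4 q1 q2 q3 q4 k1 k2 k3 k4 : R) :
  2%:R^-1 * (p1 + q1 + (k1 - k2) / 2%:R + (p2 + q2 + (k2 - k3) / 2%:R)
    + (p3 + q3 + (k3 - k4) / 2%:R) + (p4 + q4 + (k4 - k1) / 2%:R))
  = 2%:R^-1 * (p1 + p2 + p3 + p4) + 2%:R^-1 * (q1 + q2 + q3 + q4).
Proof. by field. Qed.

Lemma wind_mul F1 F2 (x0 x1 y0 y1 : R) :
  (forall z, z \in vertices x0 x1 y0 y1 -> F1.[z] != 0) ->
  (forall z, z \in vertices x0 x1 y0 y1 -> F2.[z] != 0) ->
  wind (F1 * F2) 1 x0 x1 y0 y1 = wind F1 1 x0 x1 y0 y1 + wind F2 1 x0 x1 y0 y1.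
Proof.
move=> F1v F2v; rewrite !windE !hprod1 !vprod1 !hrestrM !vrestrM.
rewrite !pathInd_mul ?horner_hrestr ?horner_vrestr;
  try by [apply: F1v; rewrite !inE eqxx ?orbT | apply: F2v; rewrite !inE eqxx ?orbT].
exact: half_telescope.
Qed.

(** Each edge carries [F] times the conjugate of [G], and conjugation negates the index. *)
Lemma wind_div F G (x0 x1 y0 y1 : R) :
  (forall z, z \in vertices x0 x1 y0 y1 -> F.[z] != 0) ->
  (forall z, z \in vertices x0 x1 y0 y1 -> G.[z] != 0) ->
  wind F G x0 x1 y0 y1 = wind F 1 x0 x1 y0 y1 - wind G 1 x0 x1 y0 y1.
Proof.
move=> Fv Gv; rewrite !windE !hprod1 !vprod1.
rewrite !pathInd_mul ?horner_conj ?conjc_eq0 ?horner_hrestr ?horner_vrestr;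
  try by [apply: Fv; rewrite !inE eqxx ?orbT | apply: Gv; rewrite !inE eqxx ?orbT].
by rewrite half_telescope !pathInd_conj -!opprD mulrN.
Qed.

Lemma wind_const (c : R[i]) (x0 x1 y0 y1 : R) : wind c%:P 1 x0 x1 y0 y1 = 0.
Proof.
rewrite windE !hprod1 !vprod1 /hrestr /vrestr !comp_polyC.
have E a b : pathInd a b c%:P = 0 by rewrite /pathInd /impoly map_polyC IndCr.
by rewrite !E !addr0 mulr0.
Qed.

(** For [z = u + iv] the imaginary part is constant on horizontal edges, so only the vertical ones
    count. They give half of [sg (x1 - u) - sg (x0 - u)] times the weight of [v]. At a vertex this
    would be 1/4 instead of 1/2, whence the exclusion. *)
Lemma wind_XsubC z (x0 x1 y0 y1 : R) : x0 < x1 -> y0 < y1 ->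
  z \notin vertices x0 x1 y0 y1 ->
  wind ('X - z%:P) 1 x0 x1 y0 y1 = cGamma x0 x1 y0 y1 z.
Proof.
case: z => u v x01 y01 zv; rewrite windE !hprod1 !vprod1.
have hE a b y : pathInd a b (hrestr ('X - (Complex u v)%:P) y) = 0.
  rewrite /pathInd; have -> : impoly (hrestr ('X - (Complex u v)%:P) y) = (y - v)%:P.
    apply/polyP => n; rewrite coef_impoly /hrestr comp_polyB comp_polyX comp_polyC.
    rewrite coefB coefD !coefC coefX; case: n => [|[|n]] /=; by ring.
  exact: IndCr.
have vE a b x : a < b -> pathInd a b (vrestr ('X - (Complex u v)%:P) x)
    = Num.sg (x - u) * itv_weight a b v.
  move=> ab; rewrite -Ind_constXsubC // /pathInd; congr Ind.
    apply/polyP => n; rewrite coef_repoly /vrestr comp_polyB comp_polyX comp_polyC.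
    rewrite coefB coefD coefCM !coefC coefX; case: n => [|[|n]] /=; by ring.
  apply/polyP => n; rewrite coef_impoly /vrestr comp_polyB comp_polyX comp_polyC.
  rewrite !(coefB, coefD) coefCM !coefC !coefX; case: n => [|[|n]] /=; by ring.
rewrite !hE vE // [pathInd y1 y0 _]pathIndC vE //.
rewrite /cGamma /inRect /itv_weight /=; move: zv; rewrite !inE !eq_complex /=.
have sgBE (w : R) : Num.sg (w - u) = if u == w then 0 else if u < w then 1 else -1.
  case: ltgtP => [uw|wu|->]; last by rewrite subrr sgr0.
    by rewrite gtr0_sg ?subr_gt0.
  by rewrite ltr0_sg ?subr_lt0.
rewrite !sgBE.
case: (ltgtP u x0) => ux0; case: (ltgtP u x1) => ux1;
  case: (ltgtP v y0) => vy0; case: (ltgtP v y1) => vy1 //= _;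
  by [exfalso; lra | field].
Qed.

Lemma wind_prod_XsubC (rs : seq R[i]) (x0 x1 y0 y1 : R) : x0 < x1 -> y0 < y1 ->
  (forall z, z \in rs -> z \notin vertices x0 x1 y0 y1) ->
  wind (\prod_(z <- rs) ('X - z%:P)) 1 x0 x1 y0 y1
  = \sum_(z <- rs) cGamma x0 x1 y0 y1 z.
Proof.
move=> x01 y01; elim: rs => [|w rs IHs] rsv.
  by rewrite !big_nil -[1](polyC1 R[i]) wind_const.
rewrite !big_cons wind_mul => [|z zv|z zv].
- rewrite wind_XsubC ?rsv ?mem_head // IHs // => z zrs.
  by apply: rsv; rewrite inE zrs orbT.
- rewrite -rootE root_XsubC; apply: contraTneq zv => ->.
  by apply: rsv; rewrite mem_head.
- rewrite -rootE root_prod_XsubC; apply: contraTN zv => zrs.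
  by apply: rsv; rewrite inE zrs orbT.
Qed.

(** Applied with [s] a root list repeated by multiplicity and [L] the distinct roots of both
    polynomials. *)
Lemma sum_count_mem (T : eqType) (f : T -> R) (L s : seq T) : uniq L ->
  {subset s <= L} -> \sum_(z <- L) f z * (count_mem z s)%:R = \sum_(z <- s) f z.
Proof.
move=> uL; elim: s => [|w s IHs] sL.
  by rewrite big_nil big1 // => z _; rewrite mulr0.
rewrite big_cons -IHs => [|z zs]; last by apply: sL; rewrite inE zs orbT.
under eq_bigr => z _ do rewrite /= natrD mulrDr.
rewrite big_split /=; congr (_ + _).
rewrite (bigD1_seq w) ?sL ?mem_head //= eqxx mulr1 big1 ?addr0 // => z zw.
by rewrite eq_sym (negPf zw) mulr0.
Qed.

Lemma valp_croots F G z : F != 0 -> G != 0 ->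
  valp F G z = (count_mem z (sval (closed_field_poly_normal F)))%:Z
    - (count_mem z (sval (closed_field_poly_normal G)))%:Z.
Proof.
move=> F0 G0; rewrite /valp.
have mupE (K : {poly R[i]}) : K != 0 ->
    mup z K = count_mem z (sval (closed_field_poly_normal K)).
  case: closed_field_poly_normal => rs /= EK K0; rewrite [in LHS]EK.
  rewrite -mul_polyC mupMr ?mu_prod_XsubC // rootC lead_coef_eq0 //.
by rewrite !mupE.
Qed.

End Winding.

(** * Reduction to factors without zeros at the vertices *)

Theorem theorem1p14 (R : rcfType) (F G : {poly R[i]}) (x0 x1 y0 y1 : R) :
  F != 0 -> G != 0 -> x0 < x1 -> y0 < y1 ->
  valp F G (Complex x0 y0) = 0 -> valp F G (Complex x1 y0) = 0 ->
  valp F G (Complex x1 y1) = 0 -> valp F G (Complex x0 y1) = 0 ->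
  wind F G x0 x1 y0 y1 =
  \sum_(z <- undup (croots F ++ croots G) | inRect x0 x1 y0 y1 z)
     cGamma x0 x1 y0 y1 z * (valp F G z)%:~R.
Proof.
move=> F0 G0 x01 y01 v1 v2 v3 v4.
set V := vertices x0 x1 y0 y1.
have vV z : z \in V -> valp F G z = 0.
  by rewrite !inE => /or4P[]/eqP->.
have vE z := valp_croots F G z F0 G0.
rewrite /croots; move: vE.
case: (closed_field_poly_normal F) => rF /= EF.
case: (closed_field_poly_normal G) => rG /= EG vE.
set L := undup (_ ++ _); set f := cGamma x0 x1 y0 y1.
have rFL : {subset rF <= L}.
  by move=> z zr; rewrite mem_undup mem_cat mem_undup zr.
have rGL : {subset rG <= L}.
  by move=> z zr; rewrite mem_undup mem_cat !mem_undup zr orbT.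
transitivity (\sum_(z <- rF) f z - \sum_(z <- rG) f z); last first.
  rewrite -(sum_count_mem _ f L) ?undup_uniq // -(sum_count_mem _ f L rG) ?undup_uniq //.
  rewrite -sumrB [RHS]big_mkcond; apply: eq_bigr => z _ /=.
  rewrite vE; case: ifP => [_|nz]; first by rewrite rmorphB mulrBr.
  by rewrite /f /cGamma nz; case: ifP nz => [/andP[/andP[a b] /andP[c d]]|];
    rewrite ?mul0r ?subr0 // /inRect !ltW.
(* Valuation 0 at a vertex means equal multiplicities, so the vertex roots of [F] and [G] agree up
   to order. *)
have pFG : perm_eq [seq z <- rF | z \in V] [seq z <- rG | z \in V].
  apply/allP => z _ /=; rewrite !count_filter.
  have [zV|zV] := boolP (z \in V).
    have := vE z; rewrite vV // => /esym/eqP; rewrite subr_eq0 => /eqP[E].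
    have cE (s : seq R[i]) : count (predI (pred1 z) (mem V)) s = count_mem z s.
      by apply: eq_count => w /=; case: eqVneq => //= ->.
    by rewrite !cE E.
  have cE (s : seq R[i]) : count (predI (pred1 z) (mem V)) s = 0%N.
    rewrite -(count_pred0 s); apply: eq_count => w /=.
    by case: eqVneq => //= ->; apply: negPf.
  by rewrite !cE.
have splitS (s : seq R[i]) : \sum_(z <- s) f z =
    \sum_(z <- s | z \in V) f z + \sum_(z <- [seq z <- s | z \notin V]) f z.
  by rewrite big_filter; exact: bigID.
have sumV : \sum_(z <- rF | z \in V) f z = \sum_(z <- rG | z \in V) f z.
  by rewrite -big_filter -[RHS]big_filter; exact: perm_big.
rewrite (splitS rF) (splitS rG) sumV opprD addrACA subrr add0r.
(* [red K s] is [K] without its linear factors at the vertices; these factors form the common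
   divisor [A]. *)
pose red (K : {poly R[i]}) s :=
  (lead_coef K)%:P * \prod_(z <- [seq z <- s | z \notin V]) ('X - z%:P).
pose A := \prod_(z <- [seq z <- rF | z \in V]) ('X - z%:P).
have A0 : A != 0 by rewrite monic_neq0 ?monic_prod_XsubC.
have split (K : {poly R[i]}) s : K = lead_coef K *: \prod_(z <- s) ('X - z%:P) ->
    K = \prod_(z <- [seq z <- s | z \in V]) ('X - z%:P) * red K s.
  move=> EK; rewrite [LHS]EK -mul_polyC (bigID (mem V)) /= mulrCA.
  by rewrite /red !big_filter.
have redF : F = A * red F rF by exact: split.
have redG : G = A * red G rG by rewrite /A (perm_big _ pFG); exact: split.
have nV (s : seq R[i]) z : z \in [seq z <- s | z \notin V] -> z \notin V.
  by rewrite mem_filter => /andP[].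
have prodV (s : seq R[i]) z : z \in V ->
    (\prod_(w <- [seq z <- s | z \notin V]) ('X - w%:P)).[z] != 0.
  move=> zV; rewrite -rootE root_prod_XsubC; apply: contraTN zV; exact: nV.
have constV (K : {poly R[i]}) z : K != 0 -> (lead_coef K)%:P.[z] != 0.
  by move=> K0; rewrite hornerC lead_coef_eq0.
have redV (K : {poly R[i]}) s z : K != 0 -> z \in V -> (red K s).[z] != 0.
  by move=> K0 zV; rewrite hornerM mulf_neq0 ?constV ?prodV.
(* Once [A] is cancelled nothing vanishes at a vertex, so the quotient and product formulas apply;
   constants contribute 0. *)
rewrite redF redG wind_cancel // wind_div => [|z|z]; try exact: redV.
rewrite !wind_mul; try by move=> z zV; rewrite ?constV ?prodV.
by rewrite !wind_const !add0r !wind_prod_XsubC //; exact: nV.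
Qed.
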